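(* With transmit antenna selection among $N$ antennas, the asymptotic (large $N$) outage capacity $C_{\mathrm{out}}=F_{\mathrm{out}}^{-1}(\epsilon)$ of the secondary user at outage threshold $\epsilon$ is given by $$C_{\mathrm{out}}\approx a_N-b_N\log\log\left(\frac1\epsilon\right),$$ where the normalizing constants are $$a_N=\log\left[1+F_\gamma^{-1}\left(1-\tfrac1N\right)\right],\qquad b_N=\log\left[\frac{1+F_\gamma^{-1}\left(1-\frac1{Ne}\right)}{1+F_\gamma^{-1}\left(1-\frac1N\right)}\right].$$
   Context: Logarithms are natural and $e$ is their base. $F_\gamma$ is the cumulative distribution function of the per-antenna SINR $$\gamma=\min\left\{\frac{Q\,g}{h\,(P_p q+\sigma^2)},\ \frac{P_{\max}\,g}{P_p q+\sigma^2}\right\},$$ where $g,h,q$ are independent exponential random variables with means $\overline g,\overline h,\overline q$, and $Q$ (interference power constraint), $P_{\max}$ (maximum transmit power of the secondary transmitter), $P_p$ (primary transmit power) and $\sigma^2$ (noise power) are positive constants; $F_\gamma^{-1}$ is the inverse of $F_\gamma$. The rate using one antenna is $\log(1+\gamma)$. With antenna selection among $N$ antennas, the rate $R_{\max}$ is the maximum of the $N$ per-antenna rates, and the per-antenna SINRs are treated as i.i.d., so the maximum SINR has distribution function $[F_\gamma(x)]^N$. The outage probability at rate $r$ is $F_{\mathrm{out}}(r)=\Pr\{R_{\max}<r\}$, and $\epsilon\in(0,1)$. The symbol $\approx$ denotes the approximation obtained by replacing the distribution of $R_{\max}$ by its asymptotic Gumbel distribution $\exp\left(-e^{-(x-a_N)/b_N}\right)$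 as $N\to\infty$ and solving for the $\epsilon$-quantile. *)

(* Defs.v *)
From HB Require Import structures.
From mathcomp Require Import all_boot all_order all_algebra.
From mathcomp Require Import all_classical all_reals all_analysis.
From mathcomp Require Import measurable_realfun.

Set Implicit Arguments.
Unset Strict Implicit.
Unset Printing Implicit Defensive.

Import Order.TTheory GRing.Theory Num.Theory.
Import numFieldNormedType.Exports.

Local Open Scope classical_set_scope.
Local Open Scope ring_scope.

Definition mutually_independent d (T : measurableType d) (R : realType)
    (P : probability T R) (I : eqType) (X : I -> {RV P >-> R}) : Prop :=
  forall (s : seq I) (B : I -> set R), uniq s -> (forall i, measurable (B i)) ->
  P (\bigcap_(i in [set` s]) (X i @^-1` B i)) =
  (\prod_(i <- s) P (X i @^-1` B i))%E.

(* Laws are compared on measurable sets only: as functions on all subsets,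
   [distribution P X] and [exponential_prob] are unspecified elsewhere.
   The parameter of [exponential_prob] is the rate, i.e. the inverse mean. *)
Definition exponential_with_mean d (T : measurableType d) (R : realType)
    (P : probability T R) (X : {RV P >-> R}) (mean : R) : Prop :=
  forall A : set R, measurable A ->
  distribution P X A = exponential_prob mean^-1 A.

Definition identically_distributed d (T : measurableType d) (R : realType)
    (P : probability T R) (X Y : {RV P >-> R}) : Prop :=
  forall A : set R, measurable A -> distribution P X A = distribution P Y A.

Lemma measurable_invr (R : realType) :
  measurable_fun [set: R] (fun x : R => x^-1).
Proof.
have m0 : measurable [set 0 : R] by exact: measurable_set1.
rewrite -(setUv [set 0 : R]); apply/measurable_funU => //; first exact: measurableC.
split; first exact: measurable_fun_set1.
apply: subspace_continuous_measurable_fun; first exact: measurableC.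
apply: continuous_in_subspaceT => x; rewrite inE /= => /eqP x0.
exact: inv_continuous.
Qed.

(* [Q] is the interference power constraint and [sigma2] the noise power.
   The denominators vanish only on a null event, where [/] returns 0. *)
Definition sinr_fun (T : Type) (R : realType) (Q Pmax Pp sigma2 : R)
    (g h q : T -> R) (t : T) : R :=
  Num.min (Q * g t / (h t * (Pp * q t + sigma2)))
          (Pmax * g t / (Pp * q t + sigma2)).

Section Sinr.
Context d (T : measurableType d) (R : realType) (P : probability T R).
Variables (Q Pmax Pp sigma2 : R) (g h q : {RV P >-> R}).

Let measurable_sinr :
  measurable_fun [set: T] (sinr_fun Q Pmax Pp sigma2 g h q).
Proof.
have mW : measurable_fun [set: T] (fun t => Pp * q t + sigma2).
  by apply: measurable_funD => //; exact: measurable_funM.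
apply: measurable_minr.
  apply: measurable_funM; first exact: measurable_funM.
  by apply: (measurableT_comp (@measurable_invr R)); exact: measurable_funM.
apply: measurable_funM; first exact: measurable_funM.
exact: (measurableT_comp (@measurable_invr R)).
Qed.

HB.instance Definition _ :=
  isMeasurableFun.Build _ _ _ _ (sinr_fun Q Pmax Pp sigma2 g h q)
    measurable_sinr.

Definition sinr : {RV P >-> R} := sinr_fun Q Pmax Pp sigma2 g h q.

End Sinr.

Definition rcdf d (T : measurableType d) (R : realType) (P : probability T R)
    (X : {RV P >-> R}) (x : R) : R := fine (cdf X x).

(* Inverse of a distribution function supported on the half-line, which is
   not injective on the whole of R. *)
Definition cdf_inv (R : realType) (F : R -> R) : R -> R :=
  'pinv_(fun=> 0) (`[0, +oo[ : set R) F.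

(* Seeding the maximum with antenna 0 makes it, for N >= 1, exactly the
   maximum over the antennas 0, ..., N-1. *)
Definition max_rate (T : Type) (R : realType) (gam : nat -> T -> R) (N : nat)
    (t : T) : R :=
  \big[Num.max/ln (1 + gam 0%N t)]_(i < N) ln (1 + gam i t).

Definition outage_prob d (T : measurableType d) (R : realType)
    (P : probability T R) (gam : nat -> {RV P >-> R}) (N : nat) (r : R) : R :=
  fine (P [set t | max_rate gam N t < r]).

Definition outage_capacity d (T : measurableType d) (R : realType)
    (P : probability T R) (gam : nat -> {RV P >-> R}) (N : nat) (eps : R) : R :=
  cdf_inv (outage_prob gam N) eps.

Definition norm_a (R : realType) (F : R -> R) (N : nat) : R :=
  ln (1 + cdf_inv F (1 - N%:R^-1)).

Definition norm_b (R : realType) (F : R -> R) (N : nat) : R :=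
  ln ((1 + cdf_inv F (1 - (N%:R * expR 1)^-1)) /
      (1 + cdf_inv F (1 - N%:R^-1))).

Definition gumbel_cdf (R : realType) (a b x : R) : R :=
  expR (- expR (- ((x - a) / b))).

(* Main.v *)
Require Import Defs.
From HB Require Import structures.
From mathcomp Require Import all_boot all_order all_algebra.
From mathcomp Require Import all_classical all_reals all_analysis.
From mathcomp Require Import ring lra.
From mathcomp Require Import measurable_realfun.

Set Implicit Arguments.
Unset Strict Implicit.
Unset Printing Implicit Defensive.

Import Order.TTheory GRing.Theory Num.Theory.
Import numFieldNormedType.Exports.

Local Open Scope classical_set_scope.
Local Open Scope ring_scope.

(* Conditionally on [h] and [q] the SINR is exponential, so its tail is the
   Laplace transform [S x = E (exp (- x Z))] of the load
   [Z = (Pp q + sigma2) max (h / Q) (1 / Pmax) / gbar].  The essential infimum of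
   [Z] is [z0 = sigma2 / (Pmax gbar) > 0], whence [S (x + t) / S x] tends to
   [exp (- z0 t)].  Hence the quantiles [u N], [v N] of order [1 - 1/N] and
   [1 - 1/(N e)] tend to infinity with [v N - u N] tending to [1 / z0]; on the
   logarithmic scale [exp (a N + b N x) - 1 = u N + x / z0 + o(1)], so that
   [N S (exp (a N + b N x) - 1)] tends to [exp (- x)], which is the Gumbel limit.
   Inverting at level [eps] uses only monotonicity. *)

(** * Powers [(1 - s n) ^+ n] when [n * s n] converges *)

Lemma cvg_invn (R : realType) : (n%:R^-1 : R) @[n --> \oo] --> 0.
Proof.
apply/gtr0_cvgV0; last exact: cvgr_idn.
by near=> n; rewrite ltr0n; near: n; exact: nbhs_infty_gt.
Unshelve. all: by end_near. Qed.

(** Convergence of [n * s n] forces [s n] to tend to 0, and both ends of the bracket [exp (- s / (1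
    - s)) <= 1 - s <= exp (- s)], raised to the power [n], then tend to [exp (- c)]. *)
Lemma cvg_expn_Gumbel (R : realType) (s : nat -> R) (c : R) :
  (forall n, s n <= 1) -> n%:R * s n @[n --> \oo] --> c ->
  (1 - s n) ^+ n @[n --> \oo] --> expR (- c).
Proof.
move=> s1 nsc.
have s0 : s n @[n --> \oo] --> 0.
  have : n%:R^-1 * (n%:R * s n) @[n --> \oo] --> 0 * c.
    by apply: cvgM => //; exact: cvg_invn.
  rewrite mul0r; apply: cvg_trans; apply: near_eq_cvg.
  near=> n; rewrite mulKf// pnatr_eq0 -lt0n; near: n; exact: nbhs_infty_gt.
apply: (@squeeze_cvgr _ _ _ _
  (fun n => expR (- (n%:R * s n / (1 - s n)))) (fun n => expR (- (n%:R * s n)))).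
- near=> n.
  have sn1 : s n < 1 by near: n; apply: (cvgr_lt _ s0); exact: ltr01.
  (* Inverse form of [1 + y <= exp y] at [y = s n / (1 - s n)], where [1 + y = (1 - s n)^-1]. *)
  have lo : expR (- (s n / (1 - s n))) <= 1 - s n.
    rewrite expRN -[leRHS]invrK lef_pV2 ?posrE ?invr_gt0 ?expR_gt0 ?subr_gt0//.
    apply: le_trans (expR_ge1Dx _); rewrite le_eqVlt; apply/orP; left.
    by apply/eqP; field; lra.
  have hi : 1 - s n <= expR (- s n) by exact: expR_ge1Dx.
  rewrite -mulrA -!(mulrN n%:R) !expRM_natl.
  by rewrite !lerXn2r// nnegrE ?expR_ge0// subr_ge0.
- apply: (@cvg_comp _ _ _ _ expR); last exact: continuous_expR.
  apply: cvgN; rewrite -[X in _ --> X]mulr1.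
  apply: cvgM => //.
  have : (1 - s n)^-1 @[n --> \oo] --> (1 - 0 : R)^-1.
    apply: cvgV; first by rewrite subr0 oner_neq0.
    by apply: cvgB => //; exact: cvg_cst.
  by rewrite subr0 invr1.
- apply: (@cvg_comp _ _ _ _ expR); last exact: continuous_expR.
  exact: cvgN.
Unshelve. all: by end_near. Qed.

(** * Tails that are asymptotically exponential under translation, and the logarithmic scale *)

(** Equivalently, the nonincreasing positive function [S] composed with [ln] is regularly varying at
    infinity with index [- al]. The limit is pointwise in [t]; monotonicity supplies the uniformity
    used below. *)
Definition exponential_tail (R : realType) (al : R) (S : R -> R) : Prop :=
  [/\ forall x, 0 < S x, {homo S : x y /~ x <= y} &
      forall t, S (x + t) / S x @[x --> +oo] --> expR (- (al * t))].

(** Monotonicity of [S] brackets the ratio between those for the fixed shifts [t - d / 2] and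
    [t + d / 2], whose limits are close to the one at [t] by continuity of the exponential. *)
Lemma exponential_tail_shift (R : realType) (al : R) (S : R -> R)
    (u v : nat -> R) (t : R) :
  exponential_tail al S -> u n @[n --> \oo] --> +oo ->
  v n - u n @[n --> \oo] --> t ->
  S (v n) / S (u n) @[n --> \oo] --> expR (- (al * t)).
Proof.
move=> [S0 Smono Slim] uy vut.
have Su r : S (u n + r) / S (u n) @[n --> \oo] --> expR (- (al * r)).
  exact: (@cvg_comp _ _ _ u (fun x => S (x + r) / S x) _ _ _ uy (Slim r)).
have cexp : expR (- (al * r)) @[r --> t] --> expR (- (al * t)).
  apply: (@cvg_comp _ _ _ _ expR); last exact: continuous_expR.
  by apply: cvgN; apply: cvgM => //; exact: cvg_cst.
apply/cvgrPdist_lt => e e0.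
have [d /= d0 dE] := iffLR (cvgrPdist_lt _ _) cexp _ (divr_gt0 e0 (ltr0Sn _ 1)).
have tp : `|expR (- (al * t)) - expR (- (al * (t + d / 2)))| < e / 2.
  by apply: dE; rewrite /= opprD addNKr normrN gtr0_norm; lra.
have tm : `|expR (- (al * t)) - expR (- (al * (t - d / 2)))| < e / 2.
  by apply: dE; rewrite /= opprB addrC subrK gtr0_norm; lra.
near=> n.
have up : `|expR (- (al * (t + d / 2))) - S (u n + (t + d / 2)) / S (u n)| < e / 2.
  by near: n; apply: (iffLR (cvgrPdist_lt _ _) (Su _)); rewrite divr_gt0.
have um : `|expR (- (al * (t - d / 2))) - S (u n + (t - d / 2)) / S (u n)| < e / 2.
  by near: n; apply: (iffLR (cvgrPdist_lt _ _) (Su _)); rewrite divr_gt0.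
have : `|t - (v n - u n)| < d / 2.
  by near: n; apply: (iffLR (cvgrPdist_lt _ _) vut); rewrite divr_gt0.
rewrite ltr_norml => /andP[vl vr].
have h1 : S (u n + (t + d / 2)) / S (u n) <= S (v n) / S (u n).
  by rewrite ler_pM2r ?invr_gt0//; apply: Smono; lra.
have h2 : S (v n) / S (u n) <= S (u n + (t - d / 2)) / S (u n).
  by rewrite ler_pM2r ?invr_gt0//; apply: Smono; lra.
move: tp tm up um; rewrite !ltr_norml => /andP[? ?] /andP[? ?] /andP[? ?] /andP[? ?].
apply/andP; split; lra.
Unshelve. all: by end_near. Qed.

(** As [al > 0], the limiting ratio is strictly decreasing in the shift, so an error of [e] in
    [v n - u n] would show in the ratio. *)
Lemma exponential_tail_unshift (R : realType) (al : R) (S : R -> R)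
    (u v : nat -> R) (t : R) :
  0 < al -> exponential_tail al S -> u n @[n --> \oo] --> +oo ->
  S (v n) / S (u n) @[n --> \oo] --> expR (- (al * t)) ->
  v n - u n @[n --> \oo] --> t.
Proof.
move=> al0 [S0 Smono Slim] uy Sv.
have Su r : S (u n + r) / S (u n) @[n --> \oo] --> expR (- (al * r)).
  exact: (@cvg_comp _ _ _ u (fun x => S (x + r) / S x) _ _ _ uy (Slim r)).
have mono r r' : r < r' -> expR (- (al * r')) < expR (- (al * r)).
  by move=> rr'; rewrite ltr_expR ltrN2 ltr_pM2l.
apply/cvgrPdist_lt => e e0; near=> n; rewrite ltr_norml; apply/andP; split.
- rewrite ltNge; apply/negP => vn.
  (* The value at [t + e / 4] strictly separates the limits at [t + e / 2] and at [t]. *)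
  have h1 : S (v n) / S (u n) <= S (u n + (t + e / 2)) / S (u n).
    by rewrite ler_pM2r ?invr_gt0//; apply: Smono; lra.
  have : S (u n + (t + e / 2)) / S (u n) < expR (- (al * (t + e / 4))).
    by near: n; apply: (cvgr_lt _ (Su _)); apply: mono; lra.
  have : expR (- (al * (t + e / 4))) < S (v n) / S (u n).
    by near: n; apply: (cvgr_gt _ Sv); apply: mono; lra.
  lra.
- rewrite ltNge; apply/negP => vn.
  have h1 : S (u n + (t - e / 2)) / S (u n) <= S (v n) / S (u n).
    by rewrite ler_pM2r ?invr_gt0//; apply: Smono; lra.
  have : expR (- (al * (t - e / 4))) < S (u n + (t - e / 2)) / S (u n).
    by near: n; apply: (cvgr_gt _ (Su _)); apply: mono; lra.
  have : S (v n) / S (u n) < expR (- (al * (t - e / 4))).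
    by near: n; apply: (cvgr_lt _ Sv); apply: mono; lra.
  lra.
Unshelve. all: by end_near. Qed.

(* The normalizing constants of the maximal rate in terms of the quantiles
   [u n] and [v n] of the SINR, mapped back to the SINR scale. *)
Lemma log_normalization (R : realType) (u v : nat -> R) (s t : R) :
  (forall n, -1 < u n) -> (forall n, -1 < v n) ->
  u n @[n --> \oo] --> +oo -> v n - u n @[n --> \oo] --> s ->
  expR (ln (1 + u n) + ln ((1 + v n) / (1 + u n)) * t) - 1 - u n
    @[n --> \oo] --> s * t.
Proof.
move=> u1 v1 uy vus.
pose w n := (1 + u n)^-1; pose b n := ln ((1 + v n) / (1 + u n)).
have u0 n : 0 < 1 + u n by have := u1 n; lra.
have v0 n : 0 < 1 + v n by have := v1 n; lra.
have w0 : w n @[n --> \oo] --> 0.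
  apply/gtr0_cvgV0; first by near=> n.
  apply/cvgryPgt => A; near=> n; suff : A < u n by lra.
  by near: n; move: A; apply/cvgryPgt.
have wvu : 1 + (v n - u n) * w n @[n --> \oo] --> (1 : R).
  rewrite -[X in _ --> X]addr0; apply: cvgD; first exact: cvg_cst.
  by rewrite -(mulr0 s); exact: cvgM.
have ratio n : (1 + v n) / (1 + u n) = 1 + (v n - u n) * w n.
  by rewrite /w; field; rewrite gt_eqF.
have r0 n : 0 < 1 + (v n - u n) * w n by rewrite -ratio divr_gt0.
(* Follows from [1 - r^-1 <= ln r <= r - 1] at [r = (1 + v n) / (1 + u n)], where
   [r - 1 = (v n - u n) * w n]. *)
have bw : b n / w n @[n --> \oo] --> s.
  apply: (@squeeze_cvgr _ _ _ _
    (fun n => (v n - u n) / (1 + (v n - u n) * w n)) (fun n => v n - u n)) => //.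
  - near=> n; have wn : 0 < w n by rewrite invr_gt0.
    rewrite (ler_pdivlMr _ _ wn) (ler_pdivrMr _ (b n) wn) /b ratio.
    apply/andP; split; last by apply: le_ln1Dx; have := r0 n; lra.
    have rn := r0 n; set r := 1 + _ in rn *.
    have -> : (v n - u n) / r * w n = 1 - r^-1.
      by rewrite /r; field; rewrite -/r gt_eqF.
    have ri : 0 < r^-1 by rewrite invr_gt0.
    have : ln (1 + (r^-1 - 1)) <= r^-1 - 1 by apply: le_ln1Dx; lra.
    by rewrite addrC subrK lnV ?posrE//; lra.
  - rewrite -[X in _ --> X]divr1; apply: cvgM => //; apply: cvgV => //.
have b0 : b n @[n --> \oo] --> 0.
  have : b n / w n * w n @[n --> \oo] --> s * 0 by exact: cvgM.
  rewrite mulr0; apply: cvg_trans; apply: near_eq_cvg; near=> n.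
  by rewrite divfK// gt_eqF// invr_gt0.
have bt0 : b n * t @[n --> \oo] --> 0.
  by rewrite -(mul0r t); apply: cvgM => //; exact: cvg_cst.
have bwt : b n / w n * t @[n --> \oo] --> s * t.
  by apply: cvgM => //; exact: cvg_cst.
have expE n : expR (ln (1 + u n) + b n * t) - 1 - u n
    = (1 + u n) * (expR (b n * t) - 1).
  by rewrite expRD lnK ?posrE//; ring.
rewrite (_ : (fun n => _) = (fun n => (1 + u n) * (expR (b n * t) - 1))); last first.
  by apply/funext => n; exact: expE.
(* This is [y <= exp y - 1 <= y / (1 - y)] at [y = b n * t < 1], multiplied by
   [1 + u n = (w n)^-1]. *)
apply: (@squeeze_cvgr _ _ _ _ (fun n => b n / w n * t)
  (fun n => b n / w n * t / (1 - b n * t))) => //.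
- near=> n.
  have bt1 : b n * t < 1 by near: n; apply: (cvgr_lt _ bt0); exact: ltr01.
  have -> : b n / w n * t = (1 + u n) * (b n * t) by rewrite /w invrK; ring.
  rewrite -mulrA !ler_pM2l//; apply/andP; split.
    by rewrite lerBrDl; exact: expR_ge1Dx.
  have -> : b n * t / (1 - b n * t) = (1 - b n * t)^-1 - 1 by field; lra.
  rewrite lerD2r -[leLHS]invrK lef_pV2 ?posrE ?invr_gt0 ?expR_gt0 ?subr_gt0//.
  by rewrite -expRN; exact: expR_ge1Dx.
- rewrite -[X in _ --> X]divr1; apply: cvgM => //; apply: cvgV => //.
  by rewrite -[X in _ --> X]subr0; apply: cvgB => //; exact: cvg_cst.
Unshelve. all: by end_near. Qed.

(** * Distribution functions on the half-line and their quantiles *)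

Lemma set_bij_cdf (R : realType) (F : R -> R) :
  continuous F -> F 0 = 0 -> {in `[0, +oo[ &, {homo F : x y / x < y}} ->
  F x @[x --> +oo] --> (1 : R) -> set_bij `[0, +oo[ `[0, 1[ F.
Proof.
move=> Fc F0 Finc F1.
have Fmono : {in `[0, +oo[ &, {homo F : x y / x <= y}}.
  move=> x y x0 y0; rewrite le_eqVlt => /predU1P[->//|xy].
  by apply/ltW/Finc.
(* Strict growth keeps [F] from reaching its limit 1, whence the half-open codomain. *)
have Flt1 x : 0 <= x -> F x < 1.
  move=> x0; have Fx : F x < F (x + 1).
    by apply: Finc; rewrite ?in_itv/= ?andbT//; lra.
  apply: (lt_le_trans Fx); apply: (cvgr_to_ge F1); near=> y.
  by apply: Fmono; rewrite ?in_itv/= ?andbT//; lra.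
split.
- move=> x /=; rewrite !in_itv/= andbT => x0; rewrite Flt1// andbT -F0.
  by apply: Fmono; rewrite ?in_itv/= ?andbT.
- move=> x y /set_mem /= x0 /set_mem /= y0 Fxy.
  apply/eqP; rewrite eq_le !leNgt; apply/andP; split; apply/negP => xy.
    by have := Finc _ _ y0 x0 xy; rewrite Fxy ltxx.
  by have := Finc _ _ x0 y0 xy; rewrite Fxy ltxx.
- move=> p /=; rewrite in_itv/= => /andP[p0 p1].
  have [y /andP[y0 py]] : exists y, (0 <= y) && (p <= F y).
    near (pinfty_nbhs R) => y; exists y; apply/andP; split.
      by near: y; apply: nbhs_pinfty_ge; rewrite num_real.
    by apply: ltW; near: y; apply: (cvgr_gt _ F1).
  have [||x] := @IVT R F 0 y p y0.
  + exact: continuous_subspaceT.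
  + by rewrite F0 ge_min le_max p0 py orbT.
  rewrite in_itv/= => /andP[x0 xy] Fx; exists x => //=.
  by rewrite in_itv/= x0.
Unshelve. all: by end_near. Qed.

Lemma cdf_invP (R : realType) (F : R -> R) (p : R) :
  set_bij `[0, +oo[ `[0, 1[ F -> 0 <= p < 1 ->
  0 <= cdf_inv F p /\ F (cdf_inv F p) = p.
Proof.
move=> Fbij p01; have pE : p \in (`[0, 1[%classic : set R) by rewrite inE/= in_itv.
split; last by rewrite /cdf_inv ((surjpK _ (set_bij_surj Fbij))).
have [+ _ _] := bijpinv_bij (fun=> 0) Fbij.
by move=> /(_ p); rewrite /= !in_itv/= andbT; exact.
Qed.

Lemma cvg_tail_quantile (R : realType) (F : R -> R) (p : nat -> R) :
  set_bij `[0, +oo[ `[0, 1[ F -> {homo F : x y / x <= y} ->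
  (forall n, 0 <= p n < 1) -> p n @[n --> \oo] --> (1 : R) ->
  cdf_inv F (p n) @[n --> \oo] --> +oo.
Proof.
move=> Fbij Fmono p01 p1; apply/cvgryPgt => A.
(* Truncation at 0 brings [A] into the half-line, where bijectivity keeps [F] below 1; the orders
   [p n] eventually exceed this value. *)
have FA1 : F (Num.max A 0) < 1.
  have [+ _ _] := Fbij => /(_ (Num.max A 0)); rewrite /= !in_itv/= le_max lexx orbT.
  by move=> /(_ isT) /andP[].
near=> n; have [xn0 Fxn] := cdf_invP Fbij (p01 n).
rewrite ltNge; apply/negP => xnA.
have : F (cdf_inv F (p n)) <= F (Num.max A 0) by apply: Fmono; rewrite le_max xnA.
rewrite Fxn leNgt => /negP; apply; near: n; exact: (cvgr_gt _ p1).
Unshelve. all: by end_near. Qed.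

Lemma norm_b_gt0 (R : realType) (F : R -> R) (N : nat) :
  set_bij `[0, +oo[ `[0, 1[ F -> {homo F : x y / x <= y} -> (0 < N)%N ->
  0 < norm_b F N.
Proof.
move=> Fbij Fmono N0; rewrite /norm_b.
have Nge1 : 1 <= N%:R :> R by rewrite ler1n.
have Ngt0 : 0 < N%:R :> R by rewrite ltr0n.
have e1 : 1 < expR 1 :> R by rewrite expR_gt1.
have Ne : (N%:R * expR 1)^-1 < N%:R^-1 :> R.
  by rewrite ltf_pV2 ?posrE ?mulr_gt0 ?expR_gt0// ltr_pMr.
have N1 : N%:R^-1 <= 1 :> R by rewrite invf_le1.
have Ne0 : 0 < (N%:R * expR 1)^-1 :> R by rewrite invr_gt0 mulr_gt0 ?expR_gt0.
have [| x0 Fx] := @cdf_invP _ F (1 - N%:R^-1) Fbij; first by apply/andP; split; lra.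
have [| y0 Fy] := @cdf_invP _ F (1 - (N%:R * expR 1)^-1) Fbij.
  by apply/andP; split; lra.
apply: ln_gt0; rewrite ltr_pdivlMr ?mul1r; last by lra.
rewrite ltrD2l ltNge; apply/negP => /Fmono; rewrite Fx Fy; lra.
Qed.

(** * The Gumbel limit and its inversion *)

(** The second conclusion serves to transfer the first to the outage probability, which is a power
    of [F] at nonnegative rates. *)
Lemma gumbel_limit (R : realType) (F : R -> R) (al x : R) :
  0 < al -> set_bij `[0, +oo[ `[0, 1[ F -> (forall y, 0 <= F y) ->
  exponential_tail al (fun y => 1 - F y) ->
  F (expR (norm_a F N + norm_b F N * x) - 1) ^+ N @[N --> \oo]
    --> gumbel_cdf 0 1 x /\
  \forall N \near \oo, 0 <= norm_a F N + norm_b F N * x.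
Proof.
move=> al0 Fbij F0 tailF; have [S0 Santi _] := tailF.
have Fmono : {homo F : y z / y <= z}.
  by move=> y z yz; have := Santi _ _ yz; rewrite lerD2l lerN2.
have e1 : 1 < expR 1 :> R by rewrite expR_gt1.
(* Shifting the index by one puts both orders in [[0, 1[] for every [n]. *)
pose p n : R := 1 - n.+1%:R^-1; pose p' n : R := 1 - (n.+1%:R * expR 1)^-1.
pose u n := cdf_inv F (p n); pose v n := cdf_inv F (p' n).
have Npos n : 0 < n.+1%:R^-1 :> R by rewrite invr_gt0 ltr0n.
have Nle1 n : n.+1%:R^-1 <= 1 :> R by rewrite invf_le1 ?ler1n ?ltr0n.
have p01 n : 0 <= p n < 1.
  by rewrite /p subr_ge0 Nle1 gtrBl Npos.
have p'01 n : 0 <= p' n < 1.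
  rewrite /p' invfM; have ei : 0 < (expR 1 : R)^-1 <= 1.
    by rewrite invr_gt0 expR_gt0 invf_le1 ?expR_gt0 ?ltW.
  have /andP[ei0 ei1] := ei; rewrite subr_ge0 gtrBl mulr_gt0// andbT.
  by rewrite -[leRHS]mulr1 ler_pM// ltW.
have pcvg : p n @[n --> \oo] --> (1 : R).
  rewrite -[X in _ --> X]subr0; apply: cvgB; first exact: cvg_cst.
  by rewrite (cvg_shiftS (fun n => n%:R^-1 : R)); exact: cvg_invn.
have uP n := cdf_invP Fbij (p01 n).
have vP n := cdf_invP Fbij (p'01 n).
have uy : u n @[n --> \oo] --> +oo by exact: cvg_tail_quantile.
(* The two tails are known exactly and their ratio is constantly [exp (- 1)]: the factor [e] in the
   order of the second quantile fixes the spacing at [al^-1]. *)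
have vu : v n - u n @[n --> \oo] --> al^-1.
  apply: (exponential_tail_unshift al0 tailF uy).
  rewrite mulfV ?gt_eqF// (_ : (fun n => _) = cst (expR (- 1))); first exact: cvg_cst.
  apply/funext => n /=; rewrite (uP n).2 (vP n).2 /p /p' !subKr expRN invfM mulrAC.
  by rewrite mulfV ?mul1r// gt_eqF.
have uge n : -1 < u n by have := (uP n).1; rewrite /u; lra.
have vge n : -1 < v n by have := (vP n).1; rewrite /v; lra.
pose y n := norm_a F n.+1 + norm_b F n.+1 * x.
have yu : expR (y n) - 1 - u n @[n --> \oo] --> al^-1 * x.
  exact: log_normalization.
split.
  rewrite -cvg_shiftS.
  have NS : n.+1%:R * (1 - F (expR (y n) - 1)) @[n --> \oo] --> expR (- x).
    have := exponential_tail_shift tailF uy yu.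
    rewrite mulVKf ?gt_eqF//; apply: cvg_trans; apply: near_eq_cvg; near=> n.
    by rewrite (uP n).2 /p subKr invrK mulrC.
  rewrite /gumbel_cdf subr0 divr1.
  rewrite (_ : (fun n => _) = (fun n => (1 - (1 - F (expR (y n) - 1))) ^+ n.+1)); last first.
    by apply/funext => n; rewrite subKr.
  (* The value at 0 is a filler that undoes the index shift and respects [s n <= 1]. *)
  pose s n := if n is m.+1 then 1 - F (expR (y m) - 1) else 0.
  rewrite (cvg_shiftS (fun n => (1 - s n) ^+ n)).
  apply: cvg_expn_Gumbel; last by rewrite -cvg_shiftS.
  by case=> [|n] //=; rewrite gerBl.
(* The difference between [exp (y n) - 1] and [u n] converges, while [u n] tends to infinity. *)
have : \forall n \near \oo, 0 <= y n.
  near=> n.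
  have ? : al^-1 * x - 1 < expR (y n) - 1 - u n.
    by near: n; apply: (cvgr_gt _ yu); lra.
  have ? : 1 - al^-1 * x < u n by near: n; move: (1 - al^-1 * x); apply/cvgryPgt.
  by rewrite -ler_expR expR0; lra.
move=> [M _ HM]; exists M.+1 => // -[//|n] /= Mn; exact: HM.
Unshelve. all: by end_near. Qed.

Lemma gumbel_cdf_eq (R : realType) (a b c eps : R) : 0 < b -> 0 < eps < 1 ->
  gumbel_cdf a b c = eps <-> c = a - b * ln (ln (1 / eps)).
Proof.
move=> b0 /andP[eps0 eps1].
have l0 : 0 < ln (1 / eps) by rewrite ln_gt0// div1r invf_gt1.
have epsE : eps = expR (- expR (ln (ln (1 / eps)))).
  by rewrite lnK ?posrE// div1r lnV ?posrE// opprK lnK ?posrE.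
split=> [|->].
  rewrite {1}epsE /gumbel_cdf => /expR_inj /oppr_inj /expR_inj <-.
  by field; rewrite gt_eqF.
rewrite [RHS]epsE /gumbel_cdf; congr (expR (- expR _)).
by field; rewrite gt_eqF.
Qed.

(** The Gumbel function increases strictly, so its values at [- l - e] and [- l + e] enclose [eps].
    For large [n] the values of [G n] at the rescaled points do the same, and monotonicity traps
    [C n] between these points. *)
Lemma gumbel_quantile (R : realType) (G : nat -> R -> R) (a b C : nat -> R) (eps : R) :
  0 < eps < 1 -> (\forall n \near \oo, {homo G n : x y / x <= y}) ->
  (\forall n \near \oo, 0 < b n) -> (\forall n \near \oo, G n (C n) = eps) ->
  (forall x, G n (a n + b n * x) @[n --> \oo] --> gumbel_cdf 0 1 x) ->
  (C n - (a n - b n * ln (ln (1 / eps)))) / b n @[n --> \oo] --> 0.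
Proof.
move=> eps01 Gmono b0 GC Gcvg; set l := ln (ln (1 / eps)).
have epsE : gumbel_cdf 0 1 (- l) = eps.
  by apply/gumbel_cdf_eq => //; rewrite mul1r sub0r.
have mono x y : x < y -> gumbel_cdf 0 1 x < gumbel_cdf 0 1 y :> R.
  by move=> xy; rewrite /gumbel_cdf !subr0 !divr1 ltr_expR ltrN2 ltr_expR ltrN2.
apply/cvgr0Pnorm_lt => e e0; near=> n.
have bn : 0 < b n by near: n.
have Gn : {homo G n : x y / x <= y} by near: n.
have Cn : G n (C n) = eps by near: n.
rewrite ltr_norml ltr_pdivlMr// ltr_pdivrMr//; apply/andP; split.
  rewrite ltNge; apply/negP => h.
  have : G n (C n) <= G n (a n + b n * (- l - e)) by apply: Gn; nra.
  rewrite Cn leNgt => /negP; apply; near: n; apply: (cvgr_lt _ (Gcvg _)).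
  by rewrite -epsE; apply: mono; lra.
rewrite ltNge; apply/negP => h.
have : G n (a n + b n * (- l + e)) <= G n (C n) by apply: Gn; nra.
rewrite Cn leNgt => /negP; apply; near: n; apply: (cvgr_gt _ (Gcvg _)).
by rewrite -epsE; apply: mono; lra.
Unshelve. all: by end_near. Qed.

(** * Laplace transforms of random variables bounded below *)

(* Truncating the argument at 0 makes this, when [Z] is positive, one minus
   the distribution function of [E / Z] for [E] a standard exponential variable
   independent of [Z], on the whole line. *)
Definition laplace (d : measure_display) (T : measurableType d) (R : realType)
    (P : probability T R) (Z : T -> R) (x : R) : R :=
  (\int[P]_t expR (- (Num.max x 0 * Z t)))%R.

Lemma laplace_integrable (d : measure_display) (T : measurableType d)
    (R : realType) (P : probability T R) (Z : T -> R) (x : R) :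
  measurable_fun [set: T] Z -> (forall t, 0 <= Z t) ->
  P.-integrable [set: T] (EFin \o (fun t => expR (- (Num.max x 0 * Z t)))).
Proof.
move=> mZ Z0; apply: (@le_integrable _ _ _ P _ _ _ (EFin \o cst 1)) => //.
- apply/measurable_EFinP; apply: measurableT_comp => //.
  by apply: measurableT_comp => //; exact: measurable_funM.
- move=> t _ /=; rewrite lee_fin normr1 ger0_norm ?expR_ge0// expR_le1 oppr_le0.
  by rewrite mulr_ge0// le_max lexx orbT.
- exact: finite_measure_integrable_cst.
Qed.

Lemma laplace0 (d : measure_display) (T : measurableType d) (R : realType)
    (P : probability T R) (Z : T -> R) : laplace P Z 0 = 1.
Proof.
rewrite /laplace; under eq_Rintegral do rewrite maxxx mul0r oppr0 expR0.
rewrite Rintegral_cst//= mul1r.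
by rewrite (_ : P setT = 1%E) //; exact: probability_setT.
Qed.

(** Pointwise, [exp (- y Z)] is [exp (- (y - x) Z)] times [exp (- x Z)], and [Z >= z0] bounds the
    first factor. This one estimate gives strict decrease, decay at infinity and the upper half of
    the tail limit. *)
Lemma laplace_le_exp (d : measure_display) (T : measurableType d)
    (R : realType) (P : probability T R) (Z : T -> R) (z0 x y : R) :
  measurable_fun [set: T] Z -> 0 <= z0 -> (forall t, z0 <= Z t) ->
  0 <= x <= y -> laplace P Z y <= expR (- (z0 * (y - x))) * laplace P Z x.
Proof.
move=> mZ z00 Zz0 /andP[x0 xy].
have Z0 t : 0 <= Z t by exact: le_trans (Zz0 t).
rewrite /laplace -RintegralZl//; last exact: laplace_integrable.
apply: le_Rintegral => //; first exact: laplace_integrable.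
  by have := integrableZl measurableT (expR (- (z0 * (y - x))))
    (laplace_integrable P x mZ Z0).
move=> t _; rewrite -expRD ler_expR !max_l//; last exact: le_trans xy.
by have := Zz0 t; nra.
Qed.

Lemma laplace_nonincreasing (d : measure_display) (T : measurableType d)
    (R : realType) (P : probability T R) (Z : T -> R) :
  measurable_fun [set: T] Z -> (forall t, 0 <= Z t) ->
  {homo laplace P Z : x y /~ x <= y}.
Proof.
move=> mZ Z0 x y xy; apply: le_Rintegral => //; try exact: laplace_integrable.
move=> t _; rewrite ler_expR lerN2 ler_wpM2r//.
by rewrite ge_max !le_max xy lexx orbT.
Qed.

(** A Chernoff bound: the integral is restricted to the event [Z <= c]. *)
Lemma laplace_ge_exp (d : measure_display) (T : measurableType d)
    (R : realType) (P : probability T R) (Z : T -> R) (c x : R) :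
  measurable_fun [set: T] Z -> (forall t, 0 <= Z t) -> 0 <= x ->
  expR (- (x * c)) * fine (P [set t | Z t <= c]) <= laplace P Z x.
Proof.
move=> mZ Z0 x0; set A := [set t | Z t <= c].
have mA : measurable A.
  by rewrite -[A]setTI; exact: measurable_fun_le.
have iA : P.-integrable [set: T] (EFin \o (\1_A : T -> R)).
  apply: (@le_integrable _ _ _ P _ _ _ (EFin \o cst 1)) => //.
  - exact/measurable_EFinP.
  - by move=> t _ /=; rewrite lee_fin normr1 indicE; case: (t \in A); rewrite ?normr1 ?normr0.
  - exact: finite_measure_integrable_cst.
have -> : fine (P A) = (\int[P]_t (\1_A t : R))%R.
  by rewrite /Rintegral integral_indic// setIT.
rewrite -RintegralZl//; apply: le_Rintegral => //.
- exact: (integrableZl measurableT (expR (- (x * c))) iA).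
- exact: laplace_integrable.
- move=> t _; rewrite indicE; case: (boolP (t \in A)) => [/set_mem /= Ztc|_].
    by rewrite mulr1 ler_expR lerN2 max_l// ler_wpM2l.
  by rewrite mulr0 expR_ge0.
Qed.

(** Dominated convergence: the truncation keeps the integrand at most 1 for negative arguments
    too. *)
Lemma continuous_laplace (d : measure_display) (T : measurableType d)
    (R : realType) (P : probability T R) (Z : T -> R) :
  measurable_fun [set: T] Z -> (forall t, 0 <= Z t) -> continuous (laplace P Z).
Proof.
move=> mZ Z0 x.
apply: (@continuity_under_integral _ _ _ P
  (fun x t => expR (- (Num.max x 0 * Z t))) setT measurableT (x - 1) (x + 1) _ _
  (cst 1)).
- by move=> y _; exact: laplace_integrable.
- apply/aeW => t _ y _.
  apply: (@cvg_comp _ _ _ (fun y => - (Num.max y 0 * Z t)) expR); last exact: continuous_expR.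
  apply: cvgN; apply: cvgM; last exact: cvg_cst.
  by apply: continuous_max => //; exact: cvg_cst.
- exact: finite_measure_integrable_cst.
- move=> y _; apply/aeW => t _; rewrite ger0_norm ?expR_ge0// expR_le1 oppr_le0.
  by rewrite mulr_ge0// le_max lexx orbT.
- by rewrite inE/= in_itv/=; apply/andP; split; lra.
Qed.

(* The tilted laws with density proportional to [exp (- x Z)] concentrate, as
   [x] grows, on the essential minimum [z0] of [Z]. *)
Lemma exponential_tail_laplace (d : measure_display) (T : measurableType d)
    (R : realType) (P : probability T R) (Z : T -> R) (z0 : R) :
  measurable_fun [set: T] Z -> 0 < z0 -> (forall t, z0 <= Z t) ->
  (forall e, 0 < e -> (0 < P [set t | (Z t <= z0 + e)%R])%E) ->
  exponential_tail z0 (laplace P Z).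
Proof.
move=> mZ z00 Zz0 Pz0.
have Z0 t : 0 <= Z t by apply: le_trans (Zz0 t); exact: ltW.
have m_gt0 e : 0 < e -> 0 < fine (P [set t | Z t <= z0 + e]).
  move=> e0; apply: fine_gt0; rewrite Pz0//=.
  by rewrite (le_lt_trans (probability_le1 _ _))// ?ltry//
    -[X in measurable X]setTI; exact: measurable_fun_le.
have mono := laplace_nonincreasing P mZ Z0.
have pos x : 0 < laplace P Z x.
  apply: lt_le_trans (mono _ _ (_ : x <= Num.max x 0)); last by rewrite le_max lexx.
  apply: lt_le_trans (laplace_ge_exp P (z0 + 1) mZ Z0 _).
    by rewrite mulr_gt0 ?expR_gt0// m_gt0.
  by rewrite le_max lexx orbT.
have shift t : 0 <= t ->
    laplace P Z (x + t) / laplace P Z x @[x --> +oo] --> expR (- (z0 * t)).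
  (* Let [m] be the probability of [Z <= z0 + e / 2]. Since the transform at [x] is at least
     [m exp (- x (z0 + e / 2))], subtracting [exp (- x (z0 + e))] from it costs a relative error of
     at most [exp (- x e / 2) / m]. *)
  move=> t0; have low e x : 0 < e -> 0 <= x -> expR (- (t * (z0 + e))) *
      (1 - expR (- (x * (e / 2))) / fine (P [set t | Z t <= z0 + e / 2]))
      <= laplace P Z (x + t) / laplace P Z x.
    move=> e0 x0; have me := m_gt0 _ (divr_gt0 e0 (ltr0Sn R 1)).
    rewrite ler_pdivlMr// -mulrA mulrBl mul1r.
    have Lx := laplace_ge_exp P (z0 + e / 2) mZ Z0 x0.
    apply: (@le_trans _ _ (expR (- (t * (z0 + e))) *
        (laplace P Z x - expR (- (x * (z0 + e)))))).
      rewrite ler_pM2l ?expR_gt0// lerD2l lerN2.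
      apply: le_trans (ler_wpM2l _ Lx); last by rewrite divr_ge0 ?expR_ge0// ltW.
      rewrite mulrACA mulVf ?gt_eqF// mulr1 -expRD ler_expR; lra.
    have ic : P.-integrable setT (EFin \o cst (expR (- (x * (z0 + e))))).
      exact: finite_measure_integrable_cst.
    have iB := integrableB measurableT (laplace_integrable P x mZ Z0) ic.
    have cE : expR (- (x * (z0 + e))) = (\int[P]_t (cst (expR (- (x * (z0 + e)))) t))%R.
      rewrite Rintegral_cst//= (_ : P setT = 1%E) ?mulr1//; exact: probability_setT.
    rewrite cE -RintegralB//; last exact: laplace_integrable.
    rewrite -RintegralZl//; apply: le_Rintegral => //; last first.
    (* Up to [z0 + e] the factor [exp (- t Z)] is at least [exp (- t (z0 + e))]; beyond it the left
       side is nonpositive. *)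
    - move=> s _; rewrite !max_l//; last by rewrite addr_ge0.
      have [zs|sz] := leP (Z s) (z0 + e).
        apply: (@le_trans _ _ (expR (- (t * (z0 + e))) * expR (- (x * Z s)))).
          by rewrite ler_pM2l ?expR_gt0// gerBl expR_ge0.
        by rewrite -expRD ler_expR; nra.
      apply: (@le_trans _ _ 0); last exact: expR_ge0.
      rewrite pmulr_rle0 ?expR_gt0// subr_le0 ler_expR lerN2 ler_wpM2l//; exact: ltW.
    - exact: laplace_integrable.
    - exact: (integrableZl measurableT (expR (- (t * (z0 + e)))) iB).
  have up x : 0 <= x -> laplace P Z (x + t) / laplace P Z x <= expR (- (z0 * t)).
    move=> x0; rewrite ler_pdivrMr//.
    have := @laplace_le_exp _ _ _ P _ z0 x (x + t) mZ (ltW z00) Zz0.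
    by rewrite x0 lerDl t0 addrAC subrr add0r; exact.
  apply/cvgrPdist_lt => e e0.
  (* The witness gives [t * e' <= e / 2]; the summand 1 keeps its denominator positive at
     [t = 0]. *)
  have [e' e'0 e'E] : exists2 e', 0 < e' &
      expR (- (z0 * t)) - e / 2 <= expR (- (t * (z0 + e'))).
    exists (e / (2 * (t + 1))); first by rewrite divr_gt0// mulr_gt0//; lra.
    set e' := e / (2 * (t + 1)); have te' : t * e' <= e / 2.
      by rewrite /e' mulrA ler_pdivrMr; nra.
    have -> : - (t * (z0 + e')) = - (z0 * t) + - (t * e') by ring.
    rewrite expRD.
    have ? := expR_ge1Dx (- (t * e')).
    have ? : expR (- (z0 * t)) <= 1 by rewrite expR_le1 oppr_le0 mulr_ge0// ltW.
    have ? := expR_gt0 (- (z0 * t)).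
    nra.
  set m := fine (P [set t | Z t <= z0 + e' / 2]).
  have m0 : 0 < m by apply: m_gt0; rewrite divr_gt0.
  near=> x.
  have x0 : 0 <= x by [].
  have xm : (e / 4 * m)^-1 <= x * (e' / 2).
    by rewrite -ler_pdivrMr ?divr_gt0.
  have small : expR (- (x * (e' / 2))) / m <= e / 4.
    rewrite ler_pdivrMr// expRN invf_ple ?posrE ?expR_gt0 ?mulr_gt0 ?divr_gt0//.
    apply: (le_trans xm); apply: le_trans (expR_ge1Dx _); lra.
  have := low _ _ e'0 x0; have := up _ x0; rewrite -/m.
  set r := _ / _.
  have ? : expR (- (t * (z0 + e'))) <= 1.
    by rewrite expR_le1 oppr_le0 mulr_ge0// addr_ge0// ltW.
  have ? := expR_gt0 (- (t * (z0 + e'))).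
  move=> ? ?; rewrite ger0_norm ?subr_ge0//.
  nra.
split=> // t; have [t0|t0] := leP 0 t; first exact: shift.
(* The ratio for a negative shift is the inverse of the ratio for the shift [- t] based at
   [x + t]. *)
have tp : 0 <= - t by lra.
have : (laplace P Z (x + t + (- t)) / laplace P Z (x + t))^-1 @[x --> +oo]
    --> (expR (- (z0 * - t)))^-1.
  apply: cvgV; first by rewrite gt_eqF ?expR_gt0.
  apply: (@cvg_comp _ _ _ (fun x => x + t)
    (fun x => laplace P Z (x + (- t)) / laplace P Z x)); last exact: shift.
  apply/cvgryPge => A; by near=> x; rewrite -lerBlDr.
rewrite -expRN mulrN opprK; apply: cvg_trans; apply: near_eq_cvg; near=> x.
by rewrite addrK invf_div.
Unshelve. all: by end_near. Qed.

(** * Independence, product laws and the exponential distribution *)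

(** Measurable rectangles form a pi-system that generates the product sigma-algebra and contains the
    whole space, where [m1] is finite. *)
Lemma measure_unique_rectangle (d1 d2 : measure_display)
    (T1 : measurableType d1) (T2 : measurableType d2) (R : realType)
    (m1 m2 : {measure set (T1 * T2) -> \bar R}) :
  (m1 setT < +oo)%E ->
  (forall A B, measurable A -> measurable B -> m1 (A `*` B) = m2 (A `*` B)) ->
  forall X, measurable X -> m1 X = m2 X.
Proof.
move=> m1T m12 X mX.
pose C : set (set (T1 * T2)) := [set Y | exists A B,
  [/\ measurable A, measurable B & Y = A `*` B]].
apply: (measure_unique C (fun=> setT)) => //.
- rewrite measurable_prod_measurableType; congr (<<s _ >>).
  rewrite predeqE => Y; split=> [[A mA [B mB <-]]|[A [B [mA mB ->]]]].
    by exists A, B.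
  by exists A => //; exists B.
- move=> _ _ [A [B [mA mB ->]]] [A' [B' [mA' mB' ->]]].
  by exists (A `&` A'), (B `&` B'); rewrite setXI; split=> //; exact: measurableI.
- by move=> _; exists setT, setT; rewrite setXTT; split.
- by rewrite bigcup_const//; exists 0%N.
- by move=> _ [A [B [mA mB ->]]]; exact: m12.
Qed.

Lemma mutually_independent3 (d : measure_display) (T : measurableType d)
    (R : realType) (P : probability T R) (X Y W : {RV P >-> R}) (A B C : set R) :
  mutually_independent (tnth [tuple X; Y; W]) ->
  measurable A -> measurable B -> measurable C ->
  P (X @^-1` A `&` (Y @^-1` B `&` W @^-1` C)) =
  (P (X @^-1` A) * (P (Y @^-1` B) * P (W @^-1` C)))%E.
Proof.
move=> indep mA mB mC; pose E i := tnth [tuple A; B; C] i.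
have mE i : measurable (E i).
  by case: i => -[|[|[|//]]] i; rewrite /E (tnth_nth set0).
have := @indep [:: ord0; lift ord0 ord0; ord_max] E isT mE.
by rewrite bigcap_seq !big_cons !big_nil setIT mule1 /E !(tnth_nth X) !(tnth_nth A).
Qed.

Lemma mutually_independent32 (d : measure_display) (T : measurableType d)
    (R : realType) (P : probability T R) (X Y W : {RV P >-> R}) (B C : set R) :
  mutually_independent (tnth [tuple X; Y; W]) -> measurable B -> measurable C ->
  P (Y @^-1` B `&` W @^-1` C) = (P (Y @^-1` B) * P (W @^-1` C))%E.
Proof.
move=> indep mB mC; have := mutually_independent3 indep measurableT mB mC.
by rewrite preimage_setT setTI probability_setT mul1e.
Qed.

(** Grouping two variables into a vector makes [g] independent of every measurable function of [h]
    and [q], in particular of the load. *)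
Lemma independent_pair (d : measure_display) (T : measurableType d)
    (R : realType) (P : probability T R) (X Y W : {RV P >-> R}) :
  mutually_independent (tnth [tuple X; Y; W]) ->
  forall (A : set R) (D : set (R * R)), measurable A -> measurable D ->
  P (X @^-1` A `&` (fun t => (Y t, W t)) @^-1` D) =
  (P (X @^-1` A) * P ((fun t => (Y t, W t)) @^-1` D))%E.
Proof.
move=> indep A D mA mD.
have mYW : measurable_fun [set: T] (fun t => (Y t, W t)).
  exact: measurable_fun_pair.
have mXA := measurable_funPTI X mA.
(* Both sides are finite measures of [D] that agree on rectangles. *)
have c0 : 0 <= fine (P (X @^-1` A)) by exact: fine_ge0.
pose c := NngNum c0.
have PA : P (X @^-1` A) = (c%:num)%:E.
  by rewrite /= fineK// fin_num_measure.
pose YW : {mfun T >-> (R * R)%type} := mfun_Sub (mem_set mYW).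
pose m1 : {measure set (R * R) -> \bar R} := pushforward (mrestr P mXA) YW.
pose m2 : {measure set (R * R) -> \bar R} := mscale c (distribution P YW).
have m12 : m1 mYW D = m2 D.
  apply: (@measure_unique_rectangle _ _ _ _ _ (m1 mYW) m2) => //.
    by rewrite /m1 /= /pushforward /mrestr (le_lt_trans (probability_le1 _ _)) ?ltry//;
      apply: measurableI => //; rewrite preimage_setT.
  move=> B C mB mC.
  rewrite /m1 /m2 /= /mscale /distribution /pushforward /mrestr /= -PA.
  have -> : (fun t => (Y t, W t)) @^-1` (B `*` C) = Y @^-1` B `&` W @^-1` C by [].
  rewrite (_ : distribution P YW _ = P (Y @^-1` B `&` W @^-1` C))//.
  by rewrite (mutually_independent32 indep)// -(mutually_independent3 indep)// setIC.
move: m12; rewrite /m1 /m2 /= /mscale /distribution /pushforward /mrestr /= -PA.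
by rewrite setIC => ->.
Qed.

(** Conditioning on [Z]: by independence the joint law is the product of the marginals, and its
    value on a region is the integral of the measures of the sections. *)
Lemma probability_independent_subgraph (d : measure_display) (T : measurableType d)
    (R : realType) (P : probability T R) (X Z : {RV P >-> R}) (f : R -> R) :
  measurable_fun [set: R] f ->
  (forall A B, measurable A -> measurable B ->
    P (X @^-1` A `&` Z @^-1` B) = (P (X @^-1` A) * P (Z @^-1` B))%E) ->
  P [set t | X t <= f (Z t)] = (\int[P]_t P (X @^-1` `]-oo, f (Z t)]))%E.
Proof.
move=> mf indep.
(* [Z] comes first because the product measure integrates over the first coordinate. *)
have mZX : measurable_fun [set: T] (fun t => (Z t, X t)) by exact: measurable_fun_pair.
pose ZX : {mfun T >-> (R * R)%type} := mfun_Sub (mem_set mZX).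
pose D : set (R * R) := [set p | p.2 <= f p.1].
have mD : measurable D.
  rewrite -[D]setTI; apply: measurable_fun_le => //.
  exact: measurableT_comp.
have -> : P [set t | X t <= f (Z t)] = distribution P ZX D by [].
rewrite -(@product_measure_unique _ _ _ _ _ (distribution P Z) (distribution P X)
  (distribution P ZX))//; last first.
  move=> A B mA mB; rewrite /distribution /pushforward /= muleC -indep//.
  by rewrite setIC.
rewrite /product_measure1.
rewrite ge0_integral_distribution//; last exact: measurable_fun_xsection.
apply: eq_integral => t _ /=; rewrite /distribution /pushforward; congr (P (_ @^-1` _)).
by apply/seteqP; split => x; rewrite /xsection /= in_itv/= inE.
Qed.

(** The density vanishes on negative numbers and points are null, so a single formula with [y]
    truncated at 0 covers the whole line. *)
Lemma exponential_cdf (d : measure_display) (T : measurableType d)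
    (R : realType) (P : probability T R) (X : {RV P >-> R}) (m y : R) :
  0 < m -> exponential_with_mean X m ->
  P (X @^-1` `]-oo, y]) = (1 - expR (- (Num.max y 0 / m)))%:E.
Proof.
move=> m0 Xm.
have neg : P (X @^-1` `]-oo, 0[) = 0%E.
  have := Xm `]-oo, 0[%classic (measurable_itv _).
  rewrite /distribution /pushforward => ->; apply: integral0_eq => x /=.
  by rewrite in_itv/= => x0; rewrite lt0_exponential_pdf.
have zero : P (X @^-1` [set 0]) = 0%E.
  have := Xm [set 0] (measurable_set1 _).
  by rewrite /distribution /pushforward => ->; exact: integral_set1.
have nonpos : P (X @^-1` `]-oo, 0]) = 0%E.
  have -> : `]-oo, 0]%classic = `]-oo, 0[ `|` [set 0] :> set R.
    apply/seteqP; split=> x /=; rewrite !in_itv/= le_eqVlt.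
      by move=> /predU1P[->|?]; [right|left].
    by move=> [->|->]; rewrite ?orbT ?eqxx.
  by rewrite preimage_setU measureU0//; exact: measurable_funPTI.
have [y0|y0] := leP y 0.
  rewrite mul0r oppr0 expR0 subrr.
  apply: (subset_measure0 _ _ _ nonpos); [exact: measurable_funPTI|exact: measurable_funPTI|].
  by move=> t /=; rewrite !in_itv/= => /le_trans; exact.
have -> : `]-oo, y]%classic = `[0, y] `|` `]-oo, 0[ :> set R.
  apply/seteqP; split=> x /=; rewrite !in_itv/=.
    by move=> xy; have [x0|x0] := leP 0 x; [left; rewrite xy|right].
  by move=> [/andP[]//|x0]; apply: ltW; exact: lt_trans y0.
rewrite preimage_setU measureU0//; [|exact: measurable_funPTI|exact: measurable_funPTI].
transitivity (exponential_prob m^-1 `[0, y]%classic).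
  exact: (Xm _ (measurable_itv _)).
rewrite exponential_prob_itv0c//.
by rewrite EFinB mulNr mulrC.
Qed.

Lemma eq_probability_null (d : measure_display) (T : measurableType d)
    (R : realType) (P : probability T R) (A B N : set T) :
  measurable A -> measurable B -> measurable N -> P N = 0%E ->
  (forall t, ~ N t -> A t <-> B t) -> P A = P B.
Proof.
move=> mA mB mN N0 AB.
suff -> : P A = P (A `|` N).
  rewrite -(measureU0 mB mN N0); congr (P _); apply/seteqP; split=> t.
    by move=> [At|Nt]; [have [Nt|/AB Nt] := pselect (N t); [right|left; apply/Nt]|right].
  by move=> [At|Nt]; [have [Nt|/AB Nt] := pselect (N t); [right|left; apply/Nt]|right].
by rewrite measureU0.
Qed.

(** * The load and the distribution function of the SINR *)

(* Truncating [q] at 0, which changes it on a null event only, makes the lower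
   bound [scaled_load_ge] hold everywhere. *)
Definition scaled_load (T : Type) (R : realType) (Q Pmax Pp sigma2 gbar : R)
    (h q : T -> R) (t : T) : R :=
  (Pp * Num.max (q t) 0 + sigma2) * Num.max (h t / Q) Pmax^-1 / gbar.

(** With [W = Pp q + sigma2], the minimum of [Q / (h W)] and [Pmax / W] is the inverse of
    [W max (h / Q) (1 / Pmax)]. *)
Lemma sinr_funE (T : Type) (R : realType) (Q Pmax Pp sigma2 gbar : R)
    (g h q : T -> R) (t : T) :
  0 < Q -> 0 < Pmax -> 0 < Pp -> 0 < sigma2 -> 0 < gbar ->
  0 <= g t -> 0 < h t -> 0 <= q t ->
  sinr_fun Q Pmax Pp sigma2 g h q t =
  g t / (gbar * scaled_load Q Pmax Pp sigma2 gbar h q t).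
Proof.
move=> Q0 Pmax0 Pp0 s0 gbar0 g0 h0 q0; rewrite /sinr_fun /scaled_load max_l//.
have W0 : 0 < Pp * q t + sigma2 by rewrite ltr_wpDl// mulr_ge0// ltW.
set W := Pp * q t + sigma2 in W0 *.
have -> : gbar * (W * Num.max (h t / Q) Pmax^-1 / gbar)
    = W * Num.max (h t / Q) Pmax^-1 by field; rewrite gt_eqF.
have hPE : (h t / Q <= Pmax^-1) = (h t * Pmax <= Q).
  by rewrite ler_pdivrMr// mulrC ler_pdivlMr.
have le2 : (Q * g t / (h t * W) <= Pmax * g t / W) = (Q * g t <= h t * Pmax * g t).
  rewrite ler_pdivrMr ?mulr_gt0// mulrAC -[X in _ = (X <= _)]mulr1.
  have -> : Pmax * g t * (h t * W) / W = h t * Pmax * g t by field; rewrite gt_eqF.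
  by rewrite mulr1.
have [hP|hP] := leP (h t / Q) Pmax^-1.
  rewrite min_r; first by field; rewrite !gt_eqF.
  rewrite ler_pdivlMr ?mulr_gt0//.
  have -> : Pmax * g t / W * (h t * W) = h t * Pmax * g t by field; rewrite gt_eqF.
  by rewrite ler_wpM2r// -hPE.
rewrite min_l; first by field; rewrite !gt_eqF.
by rewrite le2 ler_wpM2r// ltW// ltNge -hPE -ltNge.
Qed.

Lemma scaled_load_ge (T : Type) (R : realType) (Q Pmax Pp sigma2 gbar : R)
    (h q : T -> R) (t : T) :
  0 < Pmax -> 0 < Pp -> 0 < sigma2 -> 0 < gbar ->
  sigma2 / (Pmax * gbar) <= scaled_load Q Pmax Pp sigma2 gbar h q t.
Proof.
move=> Pmax0 Pp0 s0 gbar0; rewrite /scaled_load invfM mulrA.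
rewrite ler_pM2r ?invr_gt0//; apply: ler_pM.
- exact: ltW.
- by rewrite invr_ge0 ltW.
- by rewrite lerDr mulr_ge0 ?(ltW Pp0)// le_max lexx orbT.
- by rewrite le_max lexx orbT.
Qed.

Lemma measurable_scaled_load (d : measure_display) (T : measurableType d)
    (R : realType) (Q Pmax Pp sigma2 gbar : R) (h q : T -> R) :
  measurable_fun [set: T] h -> measurable_fun [set: T] q ->
  measurable_fun [set: T] (scaled_load Q Pmax Pp sigma2 gbar h q).
Proof.
move=> mh mq; apply: measurable_funM => //; apply: measurable_funM.
  apply: measurable_funD => //; apply: measurable_funM => //.
  exact: measurable_maxr.
by apply: measurable_maxr => //; exact: measurable_funM.
Qed.

(** Together with [scaled_load_ge], this makes [sigma2 / (Pmax gbar)] the essential infimum. For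
    [h <= Q / Pmax] the maximum in the load is [1 / Pmax], and a small [q] adds at most [e]; by
    independence both occur with positive probability. *)
Lemma scaled_load_min (d : measure_display) (T : measurableType d)
    (R : realType) (P : probability T R) (Q Pmax Pp sigma2 gbar hbar qbar e : R)
    (h q : {RV P >-> R}) :
  0 < Q -> 0 < Pmax -> 0 < Pp -> 0 < sigma2 -> 0 < gbar ->
  0 < hbar -> 0 < qbar ->
  exponential_with_mean h hbar -> exponential_with_mean q qbar ->
  (forall A B, measurable A -> measurable B ->
    P (h @^-1` A `&` q @^-1` B) = (P (h @^-1` A) * P (q @^-1` B))%E) ->
  0 < e ->
  (0 < P [set t | (scaled_load Q Pmax Pp sigma2 gbar h q t
                   <= sigma2 / (Pmax * gbar) + e)%R])%E.
Proof.
move=> Q0 Pmax0 Pp0 s0 gbar0 hbar0 qbar0 hexp qexp indep e0.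
(* Solution of [Pp * dl / (Pmax * gbar) = e]. *)
pose dl := e * Pmax * gbar / Pp.
have dl0 : 0 < dl by rewrite !(mulr_gt0, invr_gt0).
have cdf_gt0 (V : {RV P >-> R}) m y : 0 < m -> 0 < y -> exponential_with_mean V m ->
    (0 < P (V @^-1` `]-oo, y]))%E.
  move=> m0 y0 Vm; rewrite (exponential_cdf _ m0 Vm) lte_fin subr_gt0 expR_lt1 oppr_lt0.
  by rewrite divr_gt0// lt_max y0.
apply: (@lt_le_trans _ _ (P (h @^-1` `]-oo, Q / Pmax] `&` q @^-1` `]-oo, dl]))).
  by rewrite indep// mule_gt0//; [apply: cdf_gt0 hexp|apply: cdf_gt0 qexp] => //;
    rewrite divr_gt0.
apply: le_measure; rewrite ?inE.
- by apply: measurableI; exact: measurable_funPTI.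
- rewrite -[X in measurable X]setTI; apply: measurable_fun_le => //.
  exact: measurable_scaled_load.
- move=> t [/=]; rewrite !in_itv/= => hQ qd.
  have -> : sigma2 / (Pmax * gbar) + e = (Pp * dl + sigma2) * Pmax^-1 / gbar.
    by rewrite /dl; field; rewrite !gt_eqF.
  rewrite /scaled_load ler_pM2r ?invr_gt0//; apply: ler_pM.
  + by rewrite addr_ge0 ?(ltW s0)// mulr_ge0 ?(ltW Pp0)// le_max lexx orbT.
  + by rewrite le_max invr_ge0 (ltW Pmax0) orbT.
  + by rewrite lerD2r ler_pM2l// ge_max qd (ltW dl0).
  + by rewrite ge_max lexx andbT ler_pdivrMr// mulrC.
Qed.

Lemma sinr_cdfE (d : measure_display) (T : measurableType d)
    (R : realType) (P : probability T R) (Q Pmax Pp sigma2 gbar hbar qbar : R)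
    (g h q : {RV P >-> R}) (x : R) :
  0 < Q -> 0 < Pmax -> 0 < Pp -> 0 < sigma2 -> 0 < gbar ->
  0 < hbar -> 0 < qbar ->
  exponential_with_mean g gbar -> exponential_with_mean h hbar ->
  exponential_with_mean q qbar ->
  mutually_independent (tnth [tuple g; h; q]) ->
  rcdf (sinr Q Pmax Pp sigma2 g h q) x =
  1 - laplace P (scaled_load Q Pmax Pp sigma2 gbar h q) x.
Proof.
move=> Q0 Pmax0 Pp0 s0 gbar0 hbar0 qbar0 gexp hexp qexp indep.
have mZ : measurable_fun [set: T] (scaled_load Q Pmax Pp sigma2 gbar h q).
  exact: measurable_scaled_load.
pose Z : {RV P >-> R} := mfun_Sub (mem_set mZ).
have Zgt0 t : 0 < Z t.
  apply: lt_le_trans (scaled_load_ge _ _ _ _ Pmax0 Pp0 s0 gbar0).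
  by rewrite divr_gt0// mulr_gt0.
have gZ A B : measurable A -> measurable B ->
    P (g @^-1` A `&` Z @^-1` B) = (P (g @^-1` A) * P (Z @^-1` B))%E.
  move=> mA mB.
  pose zf := scaled_load Q Pmax Pp sigma2 gbar fst snd : R * R -> R.
  have mzf : measurable_fun [set: R * R] zf by exact: measurable_scaled_load.
  apply: (independent_pair indep mA (_ : measurable (zf @^-1` B))).
  by rewrite -[_ @^-1` _]setTI; exact: mzf.
(* Off this null event all three variables are positive and [sinr_funE] applies. *)
pose N := (g @^-1` `]-oo, 0] `|` h @^-1` `]-oo, 0]) `|` q @^-1` `]-oo, 0].
have null (V : {RV P >-> R}) m : 0 < m -> exponential_with_mean V m ->
    P (V @^-1` `]-oo, 0]) = 0%E.
  by move=> m0 Vm; rewrite (exponential_cdf _ m0 Vm) maxxx mul0r oppr0 expR0 subrr.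
have N0 : P N = 0%E.
  rewrite measureU0 ?measureU0//; try exact: measurable_funPTI; try exact: null.
    exact: (null g gbar).
  - exact: (null h hbar).
  - by apply: measurableU; exact: measurable_funPTI.
  - exact: (null q qbar).
rewrite /rcdf /cdf /distribution /pushforward.
rewrite (@eq_probability_null _ _ _ P _ [set t | g t <= x * gbar * Z t] N)//; last 4 first.
- exact: measurable_funPTI.
- by rewrite -[X in measurable X]setTI; apply: measurable_fun_le => //; exact: measurable_funM.
- by rewrite /N; do 2?apply: measurableU; exact: measurable_funPTI.
- move=> t Nt; have [g0 h0 q0] : [/\ 0 < g t, 0 < h t & 0 < q t].
    by split; rewrite ltNge; apply/negP => V0; apply: Nt; [left; left|left; right|right];
      rewrite /= in_itv.
  rewrite /= in_itv/= (sinr_funE Q0 Pmax0 Pp0 s0 gbar0 (ltW g0) h0 (ltW q0)).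
  have gZt : 0 < gbar * Z t by rewrite mulr_gt0.
  by rewrite (ler_pdivrMr _ _ gZt) mulrA.
have mf : measurable_fun [set: R] (fun z : R => x * gbar * z) by exact: measurable_funM.
rewrite (probability_independent_subgraph mf gZ).
have -> : (\int[P]_t P (g @^-1` `]-oo, (x * gbar * Z t)%R]))%E
    = (\int[P]_t ((1 - expR (- (Num.max x 0 * Z t)))%R)%:E)%E.
  apply: eq_integral => t _; rewrite (exponential_cdf _ gbar0 gexp).
  (* The nonnegative factor [gbar * Z t] leaves the maximum, after which the mean [gbar] cancels. *)
  have gZ0 : 0 <= gbar * Z t by apply: mulr_ge0; exact: ltW.
  congr ((1 - expR (- _))%:E); rewrite -[X in Num.max _ X](mul0r (gbar * Z t)) -mulrA.
  by rewrite -(maxr_pMl _ _ gZ0); field; rewrite gt_eqF.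
have iL : P.-integrable setT (EFin \o (fun t => expR (- (Num.max x 0 * Z t)))).
  by apply: laplace_integrable => // t; exact: ltW.
have := @RintegralB _ _ _ P setT (cst 1) _ measurableT
  (finite_measure_integrable_cst P 1 measurableT) iL.
rewrite {1}/Rintegral /= => ->; congr (_ - _).
by rewrite Rintegral_cst//= mul1r (_ : P setT = 1%E)//; exact: probability_setT.
Qed.

(** * The outage probability of the maximal rate *)

Lemma fine_preimage_le (d : measure_display) (T : measurableType d)
    (R : realType) (P : probability T R) (X : {RV P >-> R}) (A B : set R) :
  measurable A -> measurable B -> A `<=` B ->
  fine (P (X @^-1` A)) <= fine (P (X @^-1` B)).
Proof.
move=> mA mB AB; apply: fine_le; try by apply: fin_num_measure; exact: measurable_funPTI.
by apply: le_measure; rewrite ?inE; [exact: measurable_funPTI|exact: measurable_funPTI|move=> t; exact: AB].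
Qed.

Lemma measurable_rate_lt (R : realType) (r : R) :
  measurable [set y : R | ln (1 + y) < r].
Proof.
have mln : measurable_fun [set: R] (fun y : R => ln (1 + y)).
  by apply: (measurableT_comp (@measurable_ln R)); exact: measurable_funD.
have -> : [set y | ln (1 + y) < r] = (fun y => ln (1 + y)) @^-1` `]-oo, r[.
  by apply/seteqP; split=> y /=; rewrite in_itv.
by rewrite -[_ @^-1` _]setTI; exact: mln.
Qed.

(** A maximum is below [r] exactly when all its terms are, so independence gives a product of [N]
    equal factors. *)
Lemma outage_probE (d : measure_display) (T : measurableType d) (R : realType)
    (P : probability T R) (gam : nat -> {RV P >-> R}) (X : {RV P >-> R})
    (N : nat) (r : R) :
  (forall i, identically_distributed (gam i) X) -> mutually_independent gam ->
  (0 < N)%N ->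
  outage_prob gam N r = fine (P (X @^-1` [set y | ln (1 + y) < r])) ^+ N.
Proof.
move=> law indep N0; set B := [set y | ln (1 + y) < r].
have mB : measurable B := measurable_rate_lt r.
have -> : outage_prob gam N r =
    fine (P (\bigcap_(i in [set` iota 0 N]) (gam i @^-1` B))).
  rewrite /outage_prob; congr (fine (P _)); apply/seteqP; split=> t /=.
    move=> /bigmax_ltP[lt0 lti] i; rewrite /= mem_iota add0n => /andP[_ iN].
    exact: (lti (Ordinal iN)).
  (* The seed of the maximum is antenna 0, which is in the list because [0 < N]. *)
  move=> ltB; apply/bigmax_ltP; split; first by apply: (ltB 0%N); rewrite /= mem_iota.
  by move=> i _; apply: (ltB i); rewrite /= mem_iota /=.
rewrite (indep (iota 0 N) (fun=> B) (iota_uniq 0 N))//.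
have -> : (\prod_(i <- iota 0 N) P (gam i @^-1` B) =
    \prod_(i <- iota 0 N) (fine (P (X @^-1` B)))%:E)%E.
  apply: eq_bigr => i _; rewrite fineK; last first.
    by apply: fin_num_measure; exact: measurable_funPTI.
  exact: (law i B mB).
by rewrite prodEFin/= big_const_seq count_predT size_iota -Monoid.iteropE.
Qed.

Lemma outage_prob_nondecreasing (d : measure_display) (T : measurableType d)
    (R : realType) (P : probability T R) (gam : nat -> {RV P >-> R})
    (X : {RV P >-> R}) (N : nat) :
  (forall i, identically_distributed (gam i) X) -> mutually_independent gam ->
  (0 < N)%N -> {homo outage_prob gam N : x y / x <= y}.
Proof.
move=> law indep N0 x y xy; rewrite !(outage_probE _ law indep)//.
rewrite lerXn2r ?nnegrE ?fine_ge0//.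
apply: fine_preimage_le; [exact: measurable_rate_lt|exact: measurable_rate_lt|].
by move=> z /= /lt_le_trans; exact.
Qed.

(** The event has a strict inequality and the distribution function a large one; continuity
    reconciles them by approaching [exp r - 1] from the left. *)
Lemma rate_cdfE (d : measure_display) (T : measurableType d) (R : realType)
    (P : probability T R) (X : {RV P >-> R}) (r : R) :
  continuous (rcdf X) -> rcdf X 0 = 0 -> 0 <= r ->
  fine (P (X @^-1` [set y | ln (1 + y) < r])) = rcdf X (expR r - 1).
Proof.
move=> Fc F0 r0; set B := [set y | ln (1 + y) < r].
have mB : measurable B := measurable_rate_lt r.
have er1 : 1 <= expR r by rewrite -expR0 ler_expR.
apply/eqP; rewrite eq_le; apply/andP; split.
  apply: (@fine_preimage_le _ _ _ P X B `]-oo, expR r - 1]) => // y; rewrite /B /= in_itv/= => lny.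
  have [y1|y1] := leP (1 + y) 0; first by lra.
  by apply: ltW; rewrite ltrBrDl -[1 + y]lnK ?posrE// ltr_expR.
(* Where [1 + y <= 0] the logarithm is 0 by default: such [y] lie in [B] when [0 < r] but not when
   [r = 0], a case settled by [rcdf X 0 = 0]. *)
have [->|r_neq0] := eqVneq r 0; first by rewrite expR0 subrr F0 fine_ge0.
have rgt0 : 0 < r by rewrite lt_neqAle eq_sym r_neq0.
apply: (cvgr_to_le (cvg_at_left_filter (Fc (expR r - 1)))); near=> z.
have zr : z < expR r - 1 by near: z; exact: nbhs_left_lt.
apply: (@fine_preimage_le _ _ _ P X `]-oo, z] B) => // y; rewrite /B /= in_itv/= => yz.
have [y1|y1] := leP (1 + y) 0; first by rewrite ln0.
by rewrite -ltr_expR lnK ?posrE//; lra.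
Unshelve. all: by end_near. Qed.

Lemma set_bij_rate_cdf (R : realType) (F : R -> R) (N : nat) :
  (0 < N)%N -> continuous F -> (forall x, 0 <= F x) -> F 0 = 0 ->
  {in `[0, +oo[ &, {homo F : x y / x < y}} -> F x @[x --> +oo] --> (1 : R) ->
  set_bij `[0, +oo[ `[0, 1[ (fun r => F (expR r - 1) ^+ N).
Proof.
move=> N0 Fc Fge0 F0 Finc F1.
have expc : continuous (fun r : R => expR r - 1).
  by move=> r; apply: cvgB; [exact: continuous_expR|exact: cvg_cst].
apply: set_bij_cdf.
- move=> r; apply: (@cvg_comp _ _ _ (fun r => F (expR r - 1)) (fun z => z ^+ N)).
    by apply: (@cvg_comp _ _ _ (fun r => expR r - 1) F); [exact: expc|exact: Fc].
  exact: exprn_continuous.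
- by rewrite expR0 subrr F0 expr0n eqn0Ngt N0.
- move=> x y; rewrite !in_itv/= !andbT => x0 y0 xy.
  rewrite ltr_pXn2r ?nnegrE//.
  apply: Finc; last by rewrite ltrD2r ltr_expR.
    by rewrite in_itv/= andbT subr_ge0 -expR0 ler_expR.
  by rewrite in_itv/= andbT subr_ge0 -expR0 ler_expR.
- rewrite -[X in _ --> X](expr1n R N).
  apply: (@cvg_comp _ _ _ (fun r => F (expR r - 1)) (fun z => z ^+ N) _ _ _ _
    (@exprn_continuous R N 1)).
  apply: (@cvg_comp _ _ _ (fun r => expR r - 1) F); last exact: F1.
  apply/cvgryPge => A; near=> x; apply: (@le_trans _ _ x) => //.
  by have := expR_ge1Dx x; lra.
Unshelve. all: by end_near. Qed.

Lemma rcdf_ge0 (d : measure_display) (T : measurableType d) (R : realType)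
    (P : probability T R) (X : {RV P >-> R}) (x : R) : 0 <= rcdf X x.
Proof. by rewrite /rcdf fine_ge0// cdf_ge0. Qed.

Theorem proposition2 (d : measure_display) (T : measurableType d)
    (R : realType) (P : probability T R)
    (Q Pmax Pp sigma2 gbar hbar qbar : R)
    (g h q : {RV P >-> R}) (gam : nat -> {RV P >-> R}) (eps : R)
    (Q_gt0 : 0 < Q) (Pmax_gt0 : 0 < Pmax) (Pp_gt0 : 0 < Pp)
    (sigma2_gt0 : 0 < sigma2)
    (gbar_gt0 : 0 < gbar) (hbar_gt0 : 0 < hbar) (qbar_gt0 : 0 < qbar)
    (g_exp : exponential_with_mean g gbar)
    (h_exp : exponential_with_mean h hbar)
    (q_exp : exponential_with_mean q qbar)
    (ghq_indep : mutually_independent (tnth [tuple g; h; q]))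
    (gam_law : forall i,
       identically_distributed (gam i) (sinr Q Pmax Pp sigma2 g h q))
    (gam_indep : mutually_independent gam)
    (eps_gt0 : 0 < eps) (eps_lt1 : eps < 1) :
  let F := rcdf (sinr Q Pmax Pp sigma2 g h q) in
  let a := norm_a F in
  let b := norm_b F in
  [/\ (* the inverses of F and of the outage probability are genuine *)
      set_bij `[0, +oo[ `[0, 1[ F /\
      (forall N, (0 < N)%N -> set_bij `[0, +oo[ `[0, 1[ (outage_prob gam N)),
      (* the asymptotic distribution of the maximum rate is Gumbel *)
      (forall N, (0 < N)%N -> 0 < b N) /\
      (forall x : R,
         outage_prob gam N (a N + b N * x) @[N --> \oo] --> gumbel_cdf 0 1 x),
      (* the eps-quantile of the Gumbel approximation *)
      (forall N, (0 < N)%N -> forall c : R,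
         gumbel_cdf (a N) (b N) c = eps <->
         c = a N - b N * ln (ln (1 / eps))) &
      (* the approximation error is negligible with respect to the scale b *)
      (outage_capacity gam N eps - (a N - b N * ln (ln (1 / eps)))) / b N
        @[N --> \oo] --> 0].
Proof.
move=> F a b.
have indep_hq A B : measurable A -> measurable B ->
    P (h @^-1` A `&` q @^-1` B) = (P (h @^-1` A) * P (q @^-1` B))%E.
  exact: mutually_independent32 ghq_indep.
pose Z := scaled_load Q Pmax Pp sigma2 gbar h q.
pose z0 := sigma2 / (Pmax * gbar).
have z0_gt0 : 0 < z0 by rewrite divr_gt0// mulr_gt0.
have mZ : measurable_fun [set: T] Z by exact: measurable_scaled_load.
have Zz0 t : z0 <= Z t by exact: scaled_load_ge.
have Zge0 t : 0 <= Z t by apply: le_trans (Zz0 t); exact: ltW.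
have FE : F = (fun x => 1 - laplace P Z x).
  by apply/funext => x; exact: (sinr_cdfE _ Q_gt0 Pmax_gt0 Pp_gt0 sigma2_gt0
    gbar_gt0 hbar_gt0 qbar_gt0 g_exp h_exp q_exp ghq_indep).
have tailL : exponential_tail z0 (laplace P Z).
  apply: exponential_tail_laplace => // e e0.
  exact: (scaled_load_min Q_gt0 Pmax_gt0 Pp_gt0 sigma2_gt0 gbar_gt0 hbar_gt0
    qbar_gt0 h_exp q_exp indep_hq e0).
have [L_gt0 L_anti _] := tailL.
have tailF : exponential_tail z0 (fun y => 1 - F y).
  by rewrite (_ : (fun y => _) = laplace P Z)// FE; apply/funext => y; rewrite subKr.
have Fc : continuous F.
  by rewrite FE => x; apply: cvgB; [exact: cvg_cst|exact: continuous_laplace].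
have F0 : F 0 = 0 by rewrite FE laplace0 subrr.
have Fge0 x : 0 <= F x by exact: rcdf_ge0.
have Finc : {in `[0, +oo[ &, {homo F : x y / x < y}}.
  move=> x y; rewrite !in_itv/= !andbT => x0 y0 xy; rewrite FE ltrD2l ltrN2.
  have xy0 : 0 <= x <= y by rewrite x0 ltW.
  apply: (le_lt_trans (laplace_le_exp P mZ (ltW z0_gt0) Zz0 xy0)).
  by rewrite gtr_pMl// expR_lt1 oppr_lt0 mulr_gt0// subr_gt0.
have F1 : F x @[x --> +oo] --> (1 : R).
  rewrite FE -[X in _ --> X]subr0; apply: cvgB; first exact: cvg_cst.
  apply: (@squeeze_cvgr _ _ _ _ (cst 0) (fun x => expR (- (z0 * x)))).
  - near=> x; apply/andP; split; first exact: ltW.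
    have x0 : (0 : R) <= 0 <= x by apply/andP.
    by have := laplace_le_exp P mZ (ltW z0_gt0) Zz0 x0; rewrite laplace0 subr0 mulr1.
  - exact: cvg_cst.
  - apply: (@cvg_comp _ _ _ (fun x => z0 * x) (fun x => expR (- x))); last first.
      exact: cvgr_expR.
    apply/cvgryPge => A; near=> x; rewrite -ler_pdivrMl//.
have Fbij : set_bij `[0, +oo[ `[0, 1[ F by exact: set_bij_cdf.
have Fmono : {homo F : x y / x <= y}.
  by move=> x y xy; rewrite FE lerD2l lerN2 L_anti.
have rateE N r : (0 < N)%N -> 0 <= r -> outage_prob gam N r = F (expR r - 1) ^+ N.
  by move=> N0 r0; rewrite (outage_probE _ gam_law gam_indep N0) rate_cdfE.
have obij N : (0 < N)%N -> set_bij `[0, +oo[ `[0, 1[ (outage_prob gam N).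
  (* [rateE] identifies the outage probability with the power of [F] on the half-line, which is the
     domain of the bijection. *)
  move=> N0; apply: (eq_set_bijLR _ (set_bij_rate_cdf N0 Fc Fge0 F0 Finc F1)) => r.
  by rewrite inE/= in_itv/= andbT => r0; exact: rateE.
have b_gt0 N : (0 < N)%N -> 0 < b N by exact: norm_b_gt0.
have glim x : outage_prob gam N (a N + b N * x) @[N --> \oo] --> gumbel_cdf 0 1 x.
  have [lim near0] := gumbel_limit x z0_gt0 Fbij Fge0 tailF.
  (* For large [N] the rate [a N + b N * x] is nonnegative, as [rateE] requires. *)
  apply: cvg_trans lim; apply: near_eq_cvg; near=> N.
  by rewrite rateE//; near: N; [exact: nbhs_infty_gt|exact: near0].
have eps01 : 0 < eps < 1 by rewrite eps_gt0.
split=> //.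
  by move=> N N0 c; apply: gumbel_cdf_eq => //; exact: b_gt0.
apply: gumbel_quantile glim => //; near=> N.
- apply: (outage_prob_nondecreasing gam_law gam_indep).
  by near: N; exact: nbhs_infty_gt.
- by apply: b_gt0; near: N; exact: nbhs_infty_gt.
(* Bijectivity makes the outage capacity a true preimage of [eps]. *)
- have N0 : (0 < N)%N by near: N; exact: nbhs_infty_gt.
  by apply: (cdf_invP (obij N N0) _).2; rewrite ltW// eps_lt1.
Unshelve. all: by end_near. Qed.
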